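(* For all $n \geq 111$ and $k \in \{7,8,9,10\}$, $\mathrm{sat}(n,C_4,C_k) = 0$.
   Context: All graphs are finite and simple. A graph $G$ is $F$-free if it contains no (not necessarily induced) subgraph isomorphic to $F$. $G$ is $F$-saturated if $G$ is $F$-free but adding any nonedge to $G$ creates at least one copy of $F$. A copy of $H$ in $G$ is a (not necessarily induced) subgraph of $G$ isomorphic to $H$. $\mathrm{sat}(n,H,F)$ denotes the minimum number of copies of $H$ in an $n$-vertex $F$-saturated graph. $C_m$ is the cycle on $m$ vertices. *)

(* Defs.v *)
From HB Require Import structures.
From mathcomp Require Import all_boot.

Set Implicit Arguments.
Unset Strict Implicit.
Unset Printing Implicit Defensive.

(* Finite simple graphs on the vertex set V: an edge is a 2-element set. *)
Record sgraph (V : finType) := SGraph {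
  edges : {set {set V}};
  _ : [forall e in edges, #|e| == 2] }.

HB.instance Definition _ (V : finType) := [isSub for @edges V].
HB.instance Definition _ (V : finType) := [Countable of sgraph V by <:].
HB.instance Definition _ (V : finType) := [Finite of sgraph V by <:].

Fact edges_only_subproof (V : finType) (E : {set {set V}}) :
  [forall e in [set e in E | #|e| == 2], #|e| == 2].
Proof. by apply/forall_inP => e; rewrite inE => /andP[]. Qed.

(* Members of E that are not 2-element sets are discarded. *)
Definition graph_of (V : finType) (E : {set {set V}}) : sgraph V :=
  SGraph (edges_only_subproof E).

Definition add_edge (V : finType) (G : sgraph V) (e : {set V}) : sgraph V :=
  graph_of (e |: edges G).

(* C_m for m >= 3; ordS is the successor modulo m. *)
Definition cycle_graph (m : nat) : sgraph 'I_m :=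
  graph_of [set [set i; ordS i] | i : 'I_m].

(* A subgraph is a pair (vertex set, edge set). *)
Definition is_subgraph (V : finType) (P : {set V} * {set {set V}})
    (G : sgraph V) : bool :=
  (P.2 \subset edges G) && [forall e in P.2, e \subset P.1].

(* f is a bijection from the vertices of H onto P.1 taking the edges of H
   exactly to P.2. *)
Definition isomorphic_to (U V : finType) (H : sgraph U)
    (P : {set V} * {set {set V}}) : bool :=
  [exists f : {ffun U -> V},
    [&& injectiveb f,
        P.1 == [set f x | x : U] &
        P.2 == [set [set f x | x in e] | e : {set U} in edges H]]].

Definition copies (U V : finType) (H : sgraph U) (G : sgraph V) :
    {set {set V} * {set {set V}}} :=
  [set P | is_subgraph P G && isomorphic_to H P].

Definition num_copies (U V : finType) (H : sgraph U) (G : sgraph V) : nat :=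
  #|copies H G|.

Definition is_free (U V : finType) (F : sgraph U) (G : sgraph V) : bool :=
  copies F G == set0.

Definition saturated (U V : finType) (F : sgraph U) (G : sgraph V) : bool :=
  is_free F G &&
  [forall e : {set V},
    (#|e| == 2) && (e \notin edges G) ==> ~~ is_free F (add_edge G e)].

(* The minimum is None when there is no n-vertex F-saturated graph, so that
   sat n H F = Some m asserts in particular that the minimum is attained. *)
Definition sat (n : nat) (U W : finType) (H : sgraph U) (F : sgraph W) :
    option nat :=
  if [pick G : sgraph 'I_n | saturated F G] is Some G0 then
    Some (num_copies H
            [arg min_(G < G0 | saturated F G) num_copies H G])
  else None.

Lemma edges_add_edge (V : finType) (G : sgraph V) (e : {set V}) :
  #|e| = 2 -> edges (add_edge G e) = e |: edges G.
Proof.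
move=> e2; apply/setP => d; rewrite !inE; case: eqP => [->|_] /=.
  by rewrite e2.
case: (boolP (d \in edges G)) => //= dG.
by case: G dG => E /= /forall_inP; apply.
Qed.

Lemma edges_cycle_graph (m : nat) :
  2 < m -> edges (cycle_graph m) = [set [set i; ordS i] | i : 'I_m].
Proof.
move=> m3; apply/setP => d; rewrite inE andb_idr // => /imsetP[i _ ->].
rewrite cards2; suff -> : i != ordS i by [].
apply/eqP => /(congr1 val) /=; have := ltn_ord i.
rewrite leq_eqVlt => /predU1P[im|lt_im].
  by rewrite im modnn => i0; rewrite -im i0 in m3.
by rewrite modn_small // => /esym/eqP; rewrite eqn_leq ltnn.
Qed.

Lemma satP (n : nat) (U W : finType) (H : sgraph U) (F : sgraph W) (m : nat) :
  sat n H F = Some m <->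
  (exists2 G : sgraph 'I_n, saturated F G & num_copies H G = m) /\
  (forall G : sgraph 'I_n, saturated F G -> m <= num_copies H G).
Proof.
rewrite /sat; case: pickP => [G0 sG0|noG]; last first.
  by split=> // -[[G sG _] _]; rewrite noG in sG.
case: arg_minnP => // G sG minG; split=> [[<-]|[[G1 sG1 <-] min1]].
  by split=> //; exists G.
by congr Some; apply/eqP; rewrite eqn_leq minG // min1.
Qed.

(* Main.v *)
Require Import Defs.
From HB Require Import structures.
From mathcomp Require Import all_boot.

(** The number of copies of C_4 cannot be negative, so all that is needed is,
    for each k, one C_k-saturated graph on n vertices without a 4-cycle.

    Such graphs are glued from small pieces at a common root vertex. A cycle
    never leaves its piece, because it would have to pass through the root
    twice ([cycle_one_side]); so the glued graph has no C_4 and no C_k as soon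
    as the pieces have none. A nonedge inside a piece creates a C_k because the
    piece is itself C_k-saturated. A nonedge between different pieces creates
    one if its two ends have paths to the root whose lengths add up to k - 1.
    To guarantee this for all pairs, a list P of sets of lengths is fixed, any
    two of which (possibly equal) contain lengths with sum k - 1, and every
    vertex other than the root must realize all lengths of some set in P.
    Being saturated without C_4 and realizing P is then stable under gluing
    ([wedge_saturated]), so the possible numbers of non-root vertices form an
    additive semigroup.

    Three pieces suffice. The Petersen graph has neither a 4-cycle nor a
    7-cycle nor a Hamiltonian cycle, and nonadjacent vertices are joined by
    paths with 7 and with 10 vertices; it serves k = 7 and k = 10. Two triangles
    joined by four paths of length two serve k = 9; a triangle and an edge
    joined in this way serve k = 8. Each of them, say with s non-root vertices, remains
    suitable after a pendant vertex is attached at the right place. So s and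
    s + 1 are both available, and with them all numbers from (s - 1) s on
    ([attainable_large]); since s is 8 or 9, this covers every n > 72. That the
    six pieces have the required properties is established by enumerating
    their paths. *)

Set Implicit Arguments.
Unset Strict Implicit.
Unset Printing Implicit Defensive.

(** * Paths and cycles of a relation *)

Definition no_cycle (V : eqType) (e : rel V) (m : nat) :=
  forall s, size s = m -> uniq s -> ~~ cycle e s.

Definition joined (V : eqType) (e : rel V) (l : nat) (x y : V) :=
  exists p, [/\ path e x p, last x p = y, uniq (x :: p) & size p = l].

(** A nonedge creates a C_k exactly when its ends are joined by a path of length
    k - 1. The absence of 4-cycles is included so that both properties travel
    together through the gluing. *)
Record saturated_rel (k : nat) (V : eqType) (e : rel V) : Prop := SaturatedRel {
  saturated_sym : symmetric e;
  saturated_irr : irreflexive e;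
  saturated_no4 : no_cycle e 4;
  saturated_nok : no_cycle e k;
  saturated_joined : forall x y, x != y -> ~~ e x y -> joined e k.-1 x y }.

Section Transport.
Variables (V W : eqType) (e : rel V) (e' : rel W) (f : V -> W).
Hypothesis f_inj : injective f.

Lemma joined_map l x y :
    {homo f : u v / e u v >-> e' u v} ->
  joined e l x y -> joined e' l (f x) (f y).
Proof.
move=> fe [p [ep <- up <-]]; exists (map f p).
by split; rewrite ?last_map ?size_map ?(homo_path fe ep) // -map_cons map_inj_uniq.
Qed.

(** If no edge leaves the image of f, then a path starting in the image stays
    there and can be pulled back. *)
Lemma joined_pull l x y :
    {mono f : u v / e u v >-> e' u v} ->
    (forall u w, e' (f u) w -> exists v, w = f v) ->
  joined e' l (f x) (f y) -> joined e l x y.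
Proof.
move=> fe clos [p [ep lastp up <-]].
have [q def_p] : exists q, p = map f q.
  elim: p x ep {lastp up} => [|w p IHp] x /=; first by exists [::].
  by case/andP=> /clos[v ->] /IHp[q ->]; exists (v :: q).
exists q; rewrite def_p -map_cons (map_inj_uniq f_inj) last_map in up lastp *.
split; rewrite ?size_map //; last exact: f_inj.
by move: ep; rewrite def_p (mono_path fe).
Qed.

Lemma no_cycle_inj m :
  {homo f : u v / e u v >-> e' u v} -> no_cycle e' m -> no_cycle e m.
Proof.
move=> fe no s sz us; apply/negP => /(homo_cycle fe); apply/negP/no.
  by rewrite size_map.
by rewrite map_inj_uniq.
Qed.

End Transport.

Lemma saturated_relabel (V W : eqType) (e : rel V) k (f : W -> V) :
  bijective f -> saturated_rel k e -> saturated_rel k (relpre f e).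
Proof.
move=> f_bij [sym irr no4 nok join].
have f_inj := bij_inj f_bij.
split=> [u v|u|||x y xy exy]; rewrite /= ?irr //.
- by apply: (no_cycle_inj f_inj) no4.
- by apply: (no_cycle_inj f_inj) nok.
apply: (joined_pull f_inj _ _ (join _ _ _ exy)) => //; last by rewrite inj_eq.
by case: f_bij => g _ gK u w _; exists (g w).
Qed.

Lemma joined_sym (V : eqType) (e : rel V) l x y :
  symmetric e -> joined e l x y -> joined e l y x.
Proof.
move=> e_sym [p [ep <- up <-]]; exists (rev (belast x p)).
have rev_eq : last x p :: rev (belast x p) = rev (x :: p).
  by rewrite (lastI x p) rev_rcons.
split; last by rewrite size_rev size_belast.
- rewrite rev_path (eq_path (e' := e)) // => u v; exact: e_sym.
- by have := congr1 (last (last x p)) rev_eq; rewrite /= rev_cons last_rcons.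
- by rewrite rev_eq rev_uniq.
Qed.

Lemma path_const (V I : eqType) (e : rel V) (r : V) (b : V -> I) x p :
    (forall u v, e u v -> u != r -> v != r -> b u = b v) ->
  path e x p -> r \notin x :: p -> {in x :: p, forall u, b u = b x}.
Proof.
move=> eb; elim: p x => [|y p IHp] x /=.
  by move=> _ _ u; rewrite inE => /eqP->.
case/andP=> exy ep; rewrite inE negb_or => /andP[rx rp] u.
rewrite inE => /predU1P[-> //|u_p].
rewrite (IHp y ep rp u u_p); apply/esym/eb => //; first by rewrite eq_sym.
by move: rp; rewrite inE negb_or eq_sym => /andP[].
Qed.

(** Here b names the piece containing a vertex. Removing the root from a cycle
    leaves a single path, and a path that avoids the root cannot change
    pieces. *)
Lemma cycle_one_side (V I : eqType) (e : rel V) (r : V) (b : V -> I) s :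
    (forall u v, e u v -> u != r -> v != r -> b u = b v) ->
  cycle e s -> uniq s -> exists i, {in s, forall u, u = r \/ b u = i}.
Proof.
move=> eb; case: (boolP (r \in s)) => [r_s|rNs].
  have [i s' def_s] := rot_to r_s.
  rewrite -(rot_cycle i) -(rot_uniq i) def_s /=.
  move=> er /andP[rNs' _].
  have mem_u u : u \in s -> u \in r :: s' by rewrite -def_s mem_rot.
  case: s' er rNs' mem_u {def_s} => [|x p].
    by move=> _ _ mem_u; exists (b r) => u /mem_u; rewrite inE => /eqP; left.
  rewrite rcons_cons /= rcons_path => /and3P[_ ep _] rNp mem_u.
  exists (b x) => u /mem_u; rewrite inE => /predU1P[|u_p]; [by left | right].
  exact: path_const eb ep rNp u u_p.
case: s rNs => [|x p] rNs /=; first by exists (b r).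
rewrite rcons_path => /andP[ep _] _; exists (b x) => u u_p; right.
exact: path_const eb ep rNs u u_p.
Qed.

(** * Gluing rooted graphs *)

(** A rooted graph is a relation on [option A], with root [None]. *)
Definition anchored (P : seq (seq nat)) (A : eqType) (e : rel (option A)) :=
  forall a, exists2 S, S \in P & {in S, forall l, joined e l None (Some a)}.

Definition complementary (h : nat) (P : seq (seq nat)) :=
  all (fun S => all (fun T => has (fun i => has (fun j => i + j == h) T) S) P) P.

Definition wedge (A B : eqType) (e1 : rel (option A)) (e2 : rel (option B)) :
    rel (option (A + B)) :=
  fun u v => match u, v with
  | Some (inl a), Some (inl a') => e1 (Some a) (Some a')
  | Some (inl a), None => e1 (Some a) None
  | None, Some (inl a') => e1 None (Some a')
  | Some (inr b), Some (inr b') => e2 (Some b) (Some b')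
  | Some (inr b), None => e2 (Some b) None
  | None, Some (inr b') => e2 None (Some b')
  | _, _ => false
  end.

Section Wedge.
Variables (A B : eqType) (e1 : rel (option A)) (e2 : rel (option B)).
Let e := wedge e1 e2.
Let inL : option A -> option (A + B) := omap inl.
Let inR : option B -> option (A + B) := omap inr.

Lemma wedgeL : irreflexive e1 -> {mono inL : u v / e1 u v >-> e u v}.
Proof. by move=> irr [a|] [a'|] //=; rewrite irr. Qed.

Lemma wedgeR : irreflexive e2 -> {mono inR : u v / e2 u v >-> e u v}.
Proof. by move=> irr [a|] [a'|] //=; rewrite irr. Qed.

Let inL_inj : injective inL. Proof. by move=> [a|] [a'|] //= [->]. Qed.
Let inR_inj : injective inR. Proof. by move=> [a|] [a'|] //= [->]. Qed.

Lemma wedge_no_cycle m : no_cycle e1 m -> no_cycle e2 m -> no_cycle e m.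
Proof.
move=> no1 no2 s sz us; apply/negP => cs.
pose left (u : option (A + B)) := if u is Some (inl _) then true else false.
have e_left u v : e u v -> u != None -> v != None -> left u = left v.
  by case: u v => [[a|b]|] [[a'|b']|].
have [i side_s] := cycle_one_side e_left cs us.
(* The cycle is carried back to its piece by the map collapsing the other
   piece to the root; on the vertices of the cycle this map is injective. *)
case: i side_s => side_s.
- pose toL (u : option (A + B)) := if u is Some (inl a) then Some a else None.
  have side u : u \in s -> if u is Some (inr _) then false else true.
    by case: u => [[a|b]|] // /side_s[].
  have us' : uniq (map toL s).
    rewrite map_inj_in_uniq // => u v /side + /side.
    by case: u v => [[a|b]|] [[a'|b']|] //= _ _ [->].
  have cs' : cycle e1 (map toL s).
    apply: (@homo_cycle_in _ _ (mem s) toL e) cs; last exact/allP.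
    by move=> u v /side + /side; case: u v => [[a|b]|] [[a'|b']|].
  by have := no1 _ (etrans (size_map _ _) sz) us'; rewrite cs'.
- pose toR (u : option (A + B)) := if u is Some (inr b) then Some b else None.
  have side u : u \in s -> if u is Some (inl _) then false else true.
    by case: u => [[a|b]|] // /side_s[].
  have us' : uniq (map toR s).
    rewrite map_inj_in_uniq // => u v /side + /side.
    by case: u v => [[a|b]|] [[a'|b']|] //= _ _ [->].
  have cs' : cycle e2 (map toR s).
    apply: (@homo_cycle_in _ _ (mem s) toR e) cs; last exact/allP.
    by move=> u v /side + /side; case: u v => [[a|b]|] [[a'|b']|].
  by have := no2 _ (etrans (size_map _ _) sz) us'; rewrite cs'.
Qed.

Lemma wedge_joined i j a b :
    irreflexive e1 -> irreflexive e2 -> symmetric e1 ->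
    joined e1 i None (Some a) -> joined e2 j None (Some b) ->
  joined e (i + j) (Some (inl a)) (Some (inr b)).
Proof.
move=> irr1 irr2 sym1 /(joined_sym sym1)[p [ep lastp up <-]] [q [eq lastq uq <-]].
exists (map inL p ++ map inR q).
have lastLp : last (Some (inl a)) (map inL p) = None.
  by rewrite -[Some (inl a)]/(inL (Some a)) last_map lastp.
split; last by rewrite size_cat !size_map.
- rewrite cat_path lastLp -[Some (inl a)]/(inL (Some a)) -[None]/(inR None).
  by rewrite (mono_path (wedgeL irr1)) ep (mono_path (wedgeR irr2)).
- by rewrite last_cat lastLp -[None]/(inR None) last_map lastq.
rewrite -cat_cons cat_uniq -[Some (inl a)]/(inL (Some a)) -map_cons.
move: uq; rewrite cons_uniq => /andP[Nq uq].
rewrite (map_inj_uniq inL_inj) up (map_inj_uniq inR_inj) uq andbT.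
apply/hasPn => _ /mapP[y y_q ->].
apply/mapP => -[x _]; case: y y_q => [y|] y_q; case: x => //.
by rewrite y_q in Nq.
Qed.

Lemma wedge_saturated k P :
    complementary k.-1 P -> saturated_rel k e1 -> saturated_rel k e2 ->
    anchored P e1 -> anchored P e2 ->
  saturated_rel k e /\ anchored P e.
Proof.
move=> compl [sym1 irr1 no41 nok1 j1] [sym2 irr2 no42 nok2 j2] anc1 anc2.
have hL : {homo inL : u v / e1 u v >-> e u v}.
  by move=> u v; rewrite wedgeL.
have hR : {homo inR : u v / e2 u v >-> e u v}.
  by move=> u v; rewrite wedgeR.
have sym : symmetric e.
  by move=> [[a|b]|] [[a'|b']|] //=; rewrite ?(sym1, sym2) // sym2.
have cross a b : joined e k.-1 (Some (inl a)) (Some (inr b)).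
  have [S SP aS] := anc1 a; have [T TP bT] := anc2 b.
  have /hasP[i iS /hasP[j jT /eqP<-]] := allP (allP compl S SP) T TP.
  by apply: wedge_joined => //; [apply: aS | apply: bT].
split; last first.
  case=> [a|b].
    by have [S SP aS] := anc1 a; exists S => // l /aS /(joined_map inL_inj hL).
  by have [S SP aS] := anc2 b; exists S => // l /aS /(joined_map inR_inj hR).
split=> //; try exact: wedge_no_cycle.
  by case=> [[a|b]|] //=.
have inside1 x y : inL x != inL y -> ~~ e (inL x) (inL y) ->
    joined e k.-1 (inL x) (inL y).
  by rewrite (inj_eq inL_inj) wedgeL // => xy /(j1 _ _ xy) /(joined_map inL_inj hL).
have inside2 x y : inR x != inR y -> ~~ e (inR x) (inR y) ->
    joined e k.-1 (inR x) (inR y).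
  by rewrite (inj_eq inR_inj) wedgeR // => xy /(j2 _ _ xy) /(joined_map inR_inj hR).
move=> [[a|b]|] [[a'|b']|] //.
- exact: (inside1 (Some a) (Some a')).
- exact: (inside1 (Some a) None).
- by move=> _ _; apply: joined_sym.
- exact: (inside2 (Some b) (Some b')).
- exact: (inside2 (Some b) None).
- exact: (inside1 None (Some a')).
- exact: (inside2 None (Some b')).
Qed.

End Wedge.

(** * The semigroup of attainable sizes *)

(** The size m does not count the root, which makes sizes additive. *)
Definition attainable (k : nat) (P : seq (seq nat)) (m : nat) :=
  exists (A : finType) (e : rel (option A)),
    [/\ #|A| = m, saturated_rel k e & anchored P e].

Lemma attainable0 k P : 1 < k -> attainable k P 0.
Proof.
move=> k1; exists void, (fun _ _ => false); split; first exact: card_void.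
  split=> //; try by [case|case => [[]|] [[]|]].
  - by case=> [|[[]|] [|[[]|] s]].
  - by case=> [|[[]|] [|[[]|] s]] //= sz; move: k1; rewrite -sz.
by case.
Qed.

Lemma attainableD k P m1 m2 : complementary k.-1 P ->
  attainable k P m1 -> attainable k P m2 -> attainable k P (m1 + m2).
Proof.
move=> compl [A [e1 [<- s1 a1]]] [B [e2 [<- s2 a2]]].
have [sw aw] := wedge_saturated compl s1 s2 a1 a2.
by exists (A + B)%type, (wedge e1 e2); rewrite card_sum.
Qed.

Lemma attainableM k P m i : 1 < k -> complementary k.-1 P ->
  attainable k P m -> attainable k P (i * m).
Proof.
move=> k1 compl am; elim: i => [|i IHi]; first exact: attainable0.
by rewrite mulSn; apply: attainableD.
Qed.

(** If m = q s + r with r < s, then r <= q as soon as m >= (s - 1) s, and m is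
    the sum of q - r copies of s and r copies of s + 1. *)
Lemma attainable_large k P s m : 0 < s -> 1 < k -> complementary k.-1 P ->
    attainable k P s -> attainable k P s.+1 -> s.-1 * s <= m ->
  attainable k P m.
Proof.
move=> s0 k1 compl as0 as1 m_large.
have le_rq : m %% s <= m %/ s.
  apply: (@leq_trans s.-1); last by rewrite leq_divRL.
  by rewrite -ltnS prednK // ltn_mod.
have -> : m = (m %/ s - m %% s) * s + (m %% s) * s.+1.
  by rewrite mulnS addnCA -mulnDl subnK // addnC -divn_eq.
by apply: attainableD => //; apply: attainableM.
Qed.

(** * Checking a concrete piece *)

(** A concrete graph is given by its neighbour lists; vertex 0 is the root. *)
Definition adj (nb : seq (seq nat)) : rel nat :=
  fun x y => y \in nth [::] nb x.

Fixpoint simple_paths (nb : seq (seq nat)) (l x : nat) (seen : seq nat) :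
    seq (seq nat) :=
  if l is l'.+1 then
    flatten [seq map (cons y) (simple_paths nb l' y (y :: seen))
            | y <- nth [::] nb x & y \notin seen]
  else [:: [::]].

(** Paths avoiding the vertices in seen; called with seen = [x], this
    enumerates all paths of length l from x. *)
Lemma mem_simple_paths nb l x seen p :
  p \in simple_paths nb l x seen =
  [&& size p == l, path (adj nb) x p, uniq p & all [predC seen] p].
Proof.
elim: l x seen p => [|l IHl] x seen p /=; first by case: p.
apply/flatten_mapP/idP => [[y]|].
  rewrite mem_filter => /andP[ys xy] /mapP[q + ->] /=.
  rewrite IHl eqSS [adj nb x y]xy => /and4P[-> -> -> qs] /=.
  rewrite ys andbT; apply/andP; split.
    by apply/negP => yq; have := allP qs y yq; rewrite /= inE eqxx.
  by apply: sub_all qs => z /=; rewrite inE negb_or => /andP[].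
case: p => [|y q] //= /and4P[]; rewrite eqSS => szq /andP[xy yq] /andP[yNq uq].
move=> /andP[ys qs]; exists y; first by rewrite mem_filter ys.
apply: map_f; rewrite IHl szq yq uq /=.
apply/allP => z zq; have /= zs := allP qs z zq.
by rewrite inE negb_or zs andbT; apply: contraNneq yNq => <-.
Qed.

Definition simpleb (nb : seq (seq nat)) :=
  all (fun x => (x \notin nth [::] nb x)
                && all (fun y => adj nb y x) (nth [::] nb x))
    (iota 0 (size nb)).

Definition no_cycleb (nb : seq (seq nat)) (m : nat) :=
  all (fun x => all (fun p => ~~ adj nb (last x p) x)
                  (simple_paths nb m.-1 x [:: x]))
    (iota 0 (size nb)).

Definition linkedb (nb : seq (seq nat)) (h : nat) :=
  all (fun x => let ends := [seq last x p | p <- simple_paths nb h x [:: x]] in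
    all (fun y => [|| x == y, adj nb x y | y \in ends]) (iota 0 (size nb)))
    (iota 0 (size nb)).

Definition anchoredb (nb : seq (seq nat)) (P : seq (seq nat)) :=
  all (fun x => has (all (fun l =>
    x \in [seq last 0 p | p <- simple_paths nb l 0 [:: 0]])) P)
    (iota 1 (size nb).-1).

Definition pieceb (k : nat) (P : seq (seq nat)) (nb : seq (seq nat)) :=
  [&& simpleb nb, no_cycleb nb 4, no_cycleb nb k, linkedb nb k.-1
    & anchoredb nb P].

Section Piece.
Variables (m : nat) (nb : seq (seq nat)).
Hypotheses (size_nb : size nb = m.+1) (simple_nb : simpleb nb).

Let code (u : option 'I_m) : nat := if u is Some i then (val i).+1 else 0.
Let e : rel (option 'I_m) := relpre code (adj nb).

Let code_inj : injective code.
Proof. by move=> [i|] [j|] //= [/val_inj->]. Qed.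

Let code_mem u : code u \in iota 0 (size nb).
Proof.
by rewrite size_nb mem_iota; case: u => //= i; rewrite ltnS; apply: ltn_ord.
Qed.

Let adj_lt x y : adj nb x y -> x < m.+1.
Proof. by rewrite -size_nb; case: ltnP => // xN; rewrite /adj nth_default. Qed.

Let adj_sym : symmetric (adj nb).
Proof.
suff sym x y : adj nb x y -> adj nb y x by move=> x y; apply/idP/idP; apply: sym.
move=> xy; have x_nb : x \in iota 0 (size nb).
  by rewrite mem_iota size_nb (adj_lt xy).
by have /andP[_ /allP] := allP simple_nb x x_nb; apply.
Qed.

Let code_surj x y : adj nb x y -> exists u, y = code u.
Proof.
rewrite adj_sym => /adj_lt; case: y => [|y] ym; first by exists None.
by exists (Some (Ordinal (ym : y < m))).
Qed.

Let joined_code l x y p :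
    p \in simple_paths nb l (code x) [:: code x] ->
  last (code x) p = code y -> joined e l x y.
Proof.
rewrite mem_simple_paths => /and4P[/eqP szp ep up px] lastp.
apply: (joined_pull code_inj (e' := adj nb)) => // [u w|]; first exact: code_surj.
exists p; split=> //=; rewrite up andbT; apply/negP => xp.
by have := allP px _ xp; rewrite /= inE eqxx.
Qed.

Let no_cycle_code n : no_cycleb nb n.+1 -> no_cycle e n.+1.
Proof.
move=> no [//|x p] [szp] /= /andP[xp up]; rewrite rcons_path; apply/negP.
case/andP=> ep ex.
have p_x : map code p \in simple_paths nb n (code x) [:: code x].
  rewrite mem_simple_paths size_map szp eqxx (map_inj_uniq code_inj) up.
  rewrite path_map ep.
  apply/allP => _ /mapP[u u_p ->]; rewrite /= inE (inj_eq code_inj).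
  by apply: contraNneq xp => <-.
have := allP (allP no _ (code_mem x)) _ p_x.
by rewrite last_map -[adj _ _ _]/(e _ _) ex.
Qed.

Lemma attainable_code k P :
    [&& no_cycleb nb 4, no_cycleb nb k.+1, linkedb nb k & anchoredb nb P] ->
  attainable k.+1 P m.
Proof.
move=> /and4P[no4 nok link anc]; exists 'I_m, e; split.
- exact: card_ord.
- split=> [u v|u|||x y xy exy].
  + exact: adj_sym.
  + by apply/negbTE; have /andP[] := allP simple_nb _ (code_mem u).
  + exact: no_cycle_code.
  + exact: no_cycle_code.
  have := allP (allP link _ (code_mem x)) _ (code_mem y).
  rewrite (inj_eq code_inj) (negPf xy) -[adj _ _ _]/(e x y) (negPf exy) /=.
  by case/mapP=> p p_x lastp; apply: joined_code p_x _.
move=> i; have i_nb : code (Some i) \in iota 1 (size nb).-1.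
  by rewrite size_nb mem_iota /= add1n !ltnS ltn_ord.
have /hasP[S SP iS] := allP anc _ i_nb.
exists S => // l /(allP iS) /mapP[p p_x lastp].
exact: (@joined_code _ None (Some i) p).
Qed.

End Piece.

Lemma attainable_piece k P m nb :
  0 < k -> size nb = m.+1 -> pieceb k P nb -> attainable k P m.
Proof.
by case: k => // k _ size_nb /andP[simple_nb]; apply: attainable_code.
Qed.

(** * From relations to saturated graphs *)

Definition edge (V : finType) (G : sgraph V) : rel V :=
  fun x y => [set x; y] \in edges G.

Definition sgraph_of_rel (V : finType) (e : rel V) : sgraph V :=
  graph_of [set [set z.1; z.2] | z : V * V & e z.1 z.2].

Lemma edge_sgraph_of_rel (V : finType) (e : rel V) :
  symmetric e -> irreflexive e -> edge (sgraph_of_rel e) =2 e.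
Proof.
move=> sym irr x y; rewrite /edge inE cards2 eqSS eqb1.
apply/andP/idP => [[]|exy].
  case/imsetP=> -[u v]; rewrite inE /= => euv def_xy.
  have : x \in [set u; v] by rewrite -def_xy set21.
  have : y \in [set u; v] by rewrite -def_xy set22.
  rewrite !inE => /pred2P[]-> /pred2P[]->; rewrite ?eqxx //.
  by rewrite sym.
split; first by apply/imsetP; exists (x, y); rewrite ?inE.
by case: eqP exy => // ->; rewrite irr.
Qed.

Lemma cycle_nth (V : eqType) (e : rel V) (x0 : V) s :
  cycle e s =
    [forall i : 'I_(size s), e (nth x0 s i) (nth x0 s (i.+1 %% size s))].
Proof.
case: s => [|x p]; first by apply/esym/forallP => -[].
rewrite [cycle e _]/=; apply/(pathP x0)/forallP => [ep i|ep i].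
  have ip : i <= size p := ltn_ord i.
  have := ep i; rewrite size_rcons ltnS => /(_ ip).
  rewrite -rcons_cons !nth_rcons /= ltnS ip.
  move: ip; rewrite leq_eqVlt => /predU1P[->|ip].
    by rewrite ltnn eqxx modnn.
  by rewrite ip modn_small.
rewrite size_rcons => ip; have /= := ep (Ordinal ip).
rewrite -rcons_cons !nth_rcons /= ip.
move: ip; rewrite ltnS leq_eqVlt => /predU1P[->|ip].
  by rewrite ltnn eqxx modnn.
by rewrite ip modn_small.
Qed.

Lemma not_free_cycle (V : finType) (G : sgraph V) m : 2 < m ->
  reflect (exists2 s, size s = m & uniq s && cycle (edge G) s)
    (~~ is_free (cycle_graph m) G).
Proof.
move=> m3; apply: (iffP (set0Pn _)) => [[C]|[s szs /andP[us cs]]].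
  rewrite inE => /andP[/andP[/subsetP CG _]].
  case/existsP=> f /and3P[/injectiveP f_inj _ /eqP C2].
  have m_gt0 : 0 < m by apply: leq_trans m3.
  pose x0 := f (Ordinal m_gt0); pose t := [tuple f i | i < m].
  exists t; first exact: size_tuple.
  have -> : uniq t by apply/tuple_uniqP => i j; rewrite !tnth_mktuple => /f_inj.
  rewrite (cycle_nth _ x0) size_tuple; apply/forallP => i.
  rewrite nth_mktuple (nth_mktuple f x0 (ordS i)).
  apply: CG; rewrite C2; apply/imsetP; exists [set i; ordS i].
    by rewrite edges_cycle_graph //; apply: imset_f.
  by rewrite imsetU1 imset_set1.
have x0 : V by case: s szs m3 {us cs} => [<-|].
pose f : {ffun 'I_m -> V} := [ffun i : 'I_m => nth x0 s i].
have f_inj : injective f.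
  move=> i j; rewrite !ffunE => /eqP.
  by rewrite nth_uniq ?szs // => /eqP/val_inj.
exists ([set f x | x : 'I_m],
        [set [set f x | x in d] | d : {set 'I_m} in edges (cycle_graph m)]).
rewrite inE; apply/andP; split; last first.
  apply/existsP; exists f; rewrite !eqxx andbT.
  by apply/andP; split=> //; apply/injectiveP.
apply/andP; split; last first.
  by apply/forall_inP => _ /imsetP[d _ ->]; apply: imsetS; apply/subsetP.
apply/subsetP => _ /imsetP[d + ->]; rewrite edges_cycle_graph //.
case/imsetP=> i _ ->; rewrite imsetU1 imset_set1 !ffunE /=.
move: cs; rewrite (cycle_nth _ x0) szs => /forallP; exact.
Qed.

Lemma free_cycle (V : finType) (G : sgraph V) m : 2 < m ->
  no_cycle (edge G) m -> is_free (cycle_graph m) G.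
Proof.
move=> m3 no; apply/negPn/(not_free_cycle G m3) => -[s szs /andP[us cs]].
by have := no s szs us; rewrite cs.
Qed.

Lemma saturated_sgraph k (V : finType) (e : rel V) :
    2 < k -> saturated_rel k e ->
  saturated (cycle_graph k) (sgraph_of_rel e) /\
  num_copies (cycle_graph 4) (sgraph_of_rel e) = 0.
Proof.
move=> k3 [sym irr no4 nok join]; set G := sgraph_of_rel e.
have eG : edge G =2 e by apply: edge_sgraph_of_rel.
have free m : 2 < m -> no_cycle e m -> is_free (cycle_graph m) G.
  move=> m3 no; apply: free_cycle => // s szs us.
  by rewrite (eq_cycle eG) no.
split; last by apply/eqP; rewrite cards_eq0; apply: free.
rewrite /saturated free //; apply/forallP => d; apply/implyP => /andP[/cards2P].
case=> x [y [xy ->]]; rewrite -[_ \in _]/(edge G x y) eG => exy.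
have [p [ep lastp up szp]] := join x y xy exy.
apply/(not_free_cycle _ k3); exists (x :: p).
  by rewrite /= szp prednK // ltnW // ltnW.
have e_add u v :
    edge (add_edge G [set x; y]) u v = ([set u; v] == [set x; y]) || e u v.
  by rewrite /edge edges_add_edge ?cards2 ?xy // in_setU1 -eG.
rewrite up andTb -[cycle _ _]/(path _ x (rcons p x)) rcons_path lastp.
apply/andP; split; last by apply: etrans (e_add y x) _; rewrite setUC eqxx.
by apply: sub_path ep => u v euv; apply: etrans (e_add u v) _; rewrite euv orbT.
Qed.

Lemma attainable_sat k P m : 2 < k -> attainable k P m ->
  sat m.+1 (cycle_graph 4) (cycle_graph k) = Some 0.
Proof.
move=> k3 [A [e [cardA se _]]].
have cardV : m.+1 = #|{: option A}| by rewrite card_option cardA.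
pose f (i : 'I_m.+1) : option A := enum_val (cast_ord cardV i).
have f_bij : bijective f.
  apply: bij_comp; first exact: enum_val_bij.
  by exists (cast_ord (esym cardV)); [apply: cast_ordK | apply: cast_ordKV].
have [sG cG] := saturated_sgraph k3 (saturated_relabel f_bij se).
by apply/satP; split=> //; exists (sgraph_of_rel (relpre f e)).
Qed.

(** * The pieces *)

Definition add_pendant (nb : seq (seq nat)) (v : nat) : seq (seq nat) :=
  rcons (set_nth [::] nb v (rcons (nth [::] nb v) (size nb))) [:: v].

(** The outer 5-cycle is 0, ..., 4 and the inner pentagram 5, ..., 9. *)
Definition petersen : seq (seq nat) :=
  [:: [:: 1; 4; 5]; [:: 0; 2; 6]; [:: 1; 3; 7]; [:: 2; 4; 8]; [:: 0; 3; 9];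
      [:: 0; 7; 8]; [:: 1; 8; 9]; [:: 2; 5; 9]; [:: 3; 5; 6]; [:: 4; 6; 7]].

(** The triangles 1, 2, 3 and 4, 5, 6, joined by the paths 1-0-5, 1-7-4, 2-8-4
    and 3-9-6. *)
Definition linked_triangles : seq (seq nat) :=
  [:: [:: 1; 5]; [:: 0; 2; 3; 7]; [:: 1; 3; 8]; [:: 1; 2; 9]; [:: 5; 6; 7; 8];
      [:: 0; 4; 6]; [:: 4; 5; 9]; [:: 1; 4]; [:: 2; 4]; [:: 3; 6]].

(** The triangle 0, 1, 2 and the edge 3-4, joined by the paths 0-5-3, 0-6-4,
    1-7-3 and 2-8-4. *)
Definition triangle_linked_edge : seq (seq nat) :=
  [:: [:: 1; 2; 5; 6]; [:: 0; 2; 7]; [:: 0; 1; 8]; [:: 4; 5; 7]; [:: 3; 6; 8];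
      [:: 0; 3]; [:: 0; 4]; [:: 1; 3]; [:: 2; 4]].

Lemma sat_of_piece k P s nb v n :
    2 < k -> 0 < s -> complementary k.-1 P -> size nb = s.+1 -> v <= s ->
    pieceb k P nb -> pieceb k P (add_pendant nb v) -> s.-1 * s < n ->
  sat n (cycle_graph 4) (cycle_graph k) = Some 0.
Proof.
move=> k3 s0 compl size_nb vs piece piece'; case: n => // n n_large.
have k0 : 0 < k by apply: leq_trans k3.
have size_nb' : size (add_pendant nb v) = s.+2.
  by rewrite size_rcons size_set_nth size_nb (maxn_idPr _).
apply: (attainable_sat (P := P)) => //; apply: (attainable_large (s := s)) => //.
- exact: leq_trans k3.
- exact: attainable_piece size_nb piece.
- exact: attainable_piece size_nb' piece'.
Qed.

Theorem theorem1p10 (n k : nat) (hn : 111 <= n) (hk : k \in [:: 7; 8; 9; 10]) :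
  sat n (cycle_graph 4) (cycle_graph k) = Some 0.
Proof.
(* In each list of lengths, the first set is realized by the neighbours of the
   root and the second by the other vertices. *)
move: hk; rewrite !inE => /or4P[]/eqP->.
- apply: (@sat_of_piece 7 [:: [:: 1; 5]; [:: 3; 5]] 9 petersen 2) => //;
    by [vm_compute | apply: leq_trans hn].
- apply: (@sat_of_piece 8 [:: [:: 1; 4; 6]; [:: 3; 4]] 8 triangle_linked_edge 7)
    => //; by [vm_compute | apply: leq_trans hn].
- apply: (@sat_of_piece 9 [:: [:: 1; 7]; [:: 4; 7]] 9 linked_triangles 8) => //;
    by [vm_compute | apply: leq_trans hn].
- apply: (@sat_of_piece 10 [:: [:: 1; 8]; [:: 4; 5; 8]] 9 petersen 2) => //;
    by [vm_compute | apply: leq_trans hn].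
Qed.
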